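(* In the setting of the context, suppose the regularity assumption and the local worst-case oracle assumption hold, and fix $x\in\mathcal X$ (write $\ell_k(z)=\ell_k(x,z)$) and $i\in[N]$. For any $b,b'\in\mathbb R_+$, $$|V_i(b)-V_i(b')|\le G_i|b-b'|^{1/p},$$ where $V_i(b)=\max_{1\le k_1<k_2\le K}V_i^{(k_1,k_2)}(b)$ is the local utility defined in the context and $G_i:=\max_{k\in[K]}\max\{\|\xi\|_*:\xi\in\partial\ell_k(\hat z_i)\}$.
   Context: Notation: $[n]=\{1,\dots,n\}$; $\mathcal P(\mathcal Z)$ is the set of Borel probability measures on $\mathcal Z$; $\|\cdot\|_*$ is the dual norm of the norm $\|\cdot\|$ below; $\partial\ell_k(\hat z_i)$ is the superdifferential of the concave function $\ell_k$ at $\hat z_i$. Setting. $\mathcal X\subseteq\mathbb R^n$, $\mathcal Z\subseteq\mathbb R^m$. A transportation cost $c:\mathcal Z\times\mathcal Z\to\mathbb R_+$ is lower semicontinuous, satisfies $c(z,z)=0$ for all $z$, and $c(\cdot,\hat z)$ is convex for every fixed $\hat z\in\mathcal Z$. The optimal transport discrepancy is $\mathrm{OT}_c(\mathbb P,\mathbb Q)=\min_{\gamma}\mathbb E_{(z,\hat z)\sim\gamma}[c(z,\hat z)]$ over couplings $\gamma$ of $\mathbb P$ and $\mathbb Q$. Given $\hat z_1,\dots,\hat z_N\in\mathcal Z$, let $\hat{\mathbb P}=\frac1N\sum_{i=1}^N\delta_{\hat z_i}$; given $\rho>0$, let $\mathcal P=\{\mathbb P\in\mathcal P(\mathcal Z):\mathrm{OT}_c(\mathbb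 P,\hat{\mathbb P})\le\rho\}$. Regularity assumption. (i) $\mathcal X$ is nonempty and convex; there exist $\mathbb Q_0\in\mathcal P$ and $x_0\in\mathcal X$ such that $x\mapsto\mathbb E_{z\sim\mathbb Q_0}[\ell(x,z)]$ is inf-compact on $\mathcal X$ (all sublevel sets are compact) and $\mathbb E_{z\sim\mathbb Q_0}[\ell(x_0,z)]>-\infty$; $\mathcal Z$ is nonempty, closed and convex. (ii) $\ell(x,z)=\max_{k\in[K]}\ell_k(x,z)$ with $K\ge2$, where each $\ell_k:\mathbb R^n\times\mathbb R^m\to\mathbb R$ is real-valued, convex in its first and concave in its second argument. (iii) There exist a norm $\|\cdot\|$ on $\mathbb R^m$ and $p\ge1$ with $c(z,\hat z)\ge\|z-\hat z\|^p$ for all $z,\hat z\in\mathcal Z$; moreover, if $p=1$, then for every $x\in\mathcal X$ there exist $g>0$, $\hat z_0\in\mathcal Z$ and $r\in[0,1)$ such that $\ell(x,z)\le g[1+\|z-\hat z_0\|^r]$ for all $z\in\mathcal Z$. Local worst-case oracle assumption. For any $k\in[K]$, $\hat z\in\mathcal Z$, radius $u\ge0$ and accuracy $\epsilon>0$ there is an algorithm that returns $\hat v\in\mathbb R^m$ with $\hat z+\hat v\in\mathcal Z$, $c(\hat z+\hat v,\hat z)\le u$, together with $\hat L=\ell_k(\hat z+\hat v)\ge\max\{\ell_k(\hat z+v):v\in\mathbb R^m,\hat z+v\in\mathcal Z,c(\hat z+v,\hat z)\le u\}-\epsilon$. Local utilities. $V_i^{(k_1,k_2)}(b)$ is the maximum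 of $\alpha_1\ell_{k_1}(\hat z_i+v_1)+\alpha_2\ell_{k_2}(\hat z_i+v_2)$ over $\alpha_j,\beta_j\in\mathbb R_+$, $v_j\in\mathbb R^m$ with $\hat z_i+v_j\in\mathcal Z$, $\alpha_jc(\hat z_i+v_j,\hat z_i)\le\beta_j$ ($j=1,2$), $\alpha_1+\alpha_2=1$, $\beta_1+\beta_2=b$. *)

(* Defs.v *)
From HB Require Import structures.
From mathcomp Require Import all_boot all_order all_algebra.
From mathcomp Require Import all_classical all_reals all_analysis.

Set Implicit Arguments.
Unset Strict Implicit.
Unset Printing Implicit Defensive.

Import Order.TTheory GRing.Theory Num.Theory.
Import numFieldNormedType.Exports.

Local Open Scope classical_set_scope.
Local Open Scope ring_scope.

(* The largest element of [S]; the value is the junk value 0 when [S] has no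
   largest element, so an estimate on a [maximum] is only provable together
   with the attainment of that maximum. *)
Definition maximum (R : realType) (S : set R) : R :=
  xget 0 (S `&` ubound S).

Lemma maximumE (R : realType) (S : set R) (s : R) :
  S s -> ubound S s -> maximum S = s.
Proof.
move=> Ss uSs; apply: xget_unique => // y [Sy uSy].
by apply/eqP; rewrite eq_le uSs// uSy.
Qed.

Section Geometry.
Variables (R : realType) (m : nat).
Implicit Types (nrm f : 'rV[R]_m -> R) (v xi z : 'rV[R]_m).

Definition inner xi v : R := \sum_(j < m) xi 0 j * v 0 j.

Definition is_norm nrm : Prop :=
  [/\ forall v w, nrm (v + w) <= nrm v + nrm w,
      forall a v, nrm (a *: v) = `|a| * nrm v
    & forall v, nrm v = 0 -> v = 0].

Definition dual_norm nrm xi : R :=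
  sup [set inner xi v | v in [set v | nrm v <= 1]].

Definition concave_function (D : set 'rV[R]_m) f : Prop :=
  convex_function (D : set (convex_lmodType 'rV[R]_m)) (fun v => - f v).

Definition superdifferential f z : set 'rV[R]_m :=
  [set xi | forall w, f w <= f z + inner xi (w - z)].

End Geometry.

(* R^m with its Borel sigma-algebra. *)
Notation borel_rV R m := (g_sigma_algebraType (@open 'rV[R]_m)).

Section OptimalTransport.
Variables (R : realType) (m : nat).

(* [c] is a cost on Z x Z; its values outside Z x Z are irrelevant.  Lower
   semicontinuity is relative to Z x Z, hence the subspace topology. *)
Record transport_cost (Z : set 'rV[R]_m) (c : 'rV[R]_m -> 'rV[R]_m -> R) :
    Prop := TransportCost {
  cost_ge0 : forall z w, Z z -> Z w -> 0 <= c z w ;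
  cost_lsc : @lower_semicontinuous (subspace (Z `*` Z)) R
               (fun y => (c y.1 y.2)%:E) ;
  cost_diag : forall z, Z z -> c z z = 0 ;
  cost_convex : forall w, Z w ->
    convex_function (Z : set (convex_lmodType 'rV[R]_m)) (fun z => c z w)
}.

Definition coupling (P Q : set (borel_rV R m) -> \bar R)
    (gamma : probability ((borel_rV R m) * (borel_rV R m))%type R) : Prop :=
  forall A : set (borel_rV R m), measurable A ->
    gamma (A `*` setT) = P A /\ gamma (setT `*` A) = Q A.

(* Couplings of measures carried by Z are carried by Z x Z. *)
Definition OT (Z : set 'rV[R]_m) (c : 'rV[R]_m -> 'rV[R]_m -> R)
    (P Q : set (borel_rV R m) -> \bar R) : \bar R :=
  ereal_inf [set (\int[gamma]_(y in Z `*` Z) (c y.1 y.2)%:E)%E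
            | gamma in coupling P Q].

Definition empirical (N : nat) (zhat : 'I_N -> 'rV[R]_m)
    (A : set (borel_rV R m)) : \bar R :=
  ((N%:R^-1)%:E * \sum_(i < N) dirac (zhat i : borel_rV R m) A)%E.

(* Borel probability measures on Z are the Borel probability measures P on R^m
   with P Z = 1. *)
Definition ambiguity_set (Z : set 'rV[R]_m) (c : 'rV[R]_m -> 'rV[R]_m -> R)
    (N : nat) (zhat : 'I_N -> 'rV[R]_m) (rho : R) :
    set (probability (borel_rV R m) R) :=
  [set P | P Z = 1%E /\ (OT Z c P (empirical zhat) <= rho%:E)%E].

End OptimalTransport.

Section Assumptions.
Variables (R : realType) (n m K : nat).
Implicit Types (ell : 'I_K -> 'rV[R]_n -> 'rV[R]_m -> R).

Definition max_loss ell (x : 'rV[R]_n) (z : 'rV[R]_m) : R :=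
  maximum [set ell k x z | k in [set: 'I_K]].

Definition expected_loss (Z : set 'rV[R]_m) ell
    (Q : probability (borel_rV R m) R) (x : 'rV[R]_n) : \bar R :=
  (\int[Q]_(z in Z) (max_loss ell x z)%:E)%E.

Definition inf_compact_on (X : set 'rV[R]_n) (F : 'rV[R]_n -> \bar R) : Prop :=
  forall t : R, compact (X `&` [set x | (F x <= t%:E)%E]).

Record regularity (X : set 'rV[R]_n) (Z : set 'rV[R]_m)
    (c : 'rV[R]_m -> 'rV[R]_m -> R) (N : nat) (zhat : 'I_N -> 'rV[R]_m)
    (rho : R) ell (nrm : 'rV[R]_m -> R) (p : R) : Prop := Regularity {
  reg_X_nonempty : X !=set0 ;
  reg_X_convex : convex_set (X : set (convex_lmodType 'rV[R]_n)) ;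
  reg_inf_compact : exists Q0 x0,
    [/\ ambiguity_set Z c zhat rho Q0, X x0,
        inf_compact_on X (expected_loss Z ell Q0)
      & (-oo < expected_loss Z ell Q0 x0)%E] ;
  reg_Z_nonempty : Z !=set0 ;
  reg_Z_closed : closed Z ;
  reg_Z_convex : convex_set (Z : set (convex_lmodType 'rV[R]_m)) ;
  reg_K : (2 <= K)%N ;
  reg_convex : forall k z,
    convex_function (setT : set (convex_lmodType 'rV[R]_n))
      (fun x => ell k x z) ;
  reg_concave : forall k x, concave_function setT (ell k x) ;
  reg_norm : is_norm nrm ;
  reg_p : 1 <= p ;
  reg_cost : forall z w, Z z -> Z w -> nrm (z - w) `^ p <= c z w ;
  reg_growth : p = 1 -> forall x, X x -> exists g z0 r,
    [/\ 0 < g, Z z0, 0 <= r < 1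
      & forall z, Z z -> max_loss ell x z <= g * (1 + nrm (z - z0) `^ r)]
}.

End Assumptions.

Section LocalProblems.
Variables (R : realType) (m K : nat).
Variables (Z : set 'rV[R]_m) (c : 'rV[R]_m -> 'rV[R]_m -> R).
Variable (ell : 'I_K -> 'rV[R]_m -> R).

(* An algorithm is modelled by the function [oracle] it computes: on input
   k, z, u, eps it returns the pair of a displacement and a value. *)
Definition local_worst_case_oracle
    (oracle : 'I_K -> 'rV[R]_m -> R -> R -> 'rV[R]_m * R) : Prop :=
  forall k z u eps, Z z -> 0 <= u -> 0 < eps ->
    let vhat := (oracle k z u eps).1 in
    let Lhat := (oracle k z u eps).2 in
    [/\ Z (z + vhat), c (z + vhat) z <= u, Lhat = ell k (z + vhat)
      & maximum [set ell k (z + v)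
                | v in [set v | Z (z + v) /\ c (z + v) z <= u]] - eps <= Lhat].

Definition pair_utility (z : 'rV[R]_m) (k1 k2 : 'I_K) (b : R) : R :=
  maximum [set t | exists a1 a2 b1 b2 v1 v2,
    [/\ [/\ 0 <= a1, 0 <= a2, 0 <= b1 & 0 <= b2],
        Z (z + v1) /\ Z (z + v2),
        a1 * c (z + v1) z <= b1 /\ a2 * c (z + v2) z <= b2,
        a1 + a2 = 1 /\ b1 + b2 = b
      & t = a1 * ell k1 (z + v1) + a2 * ell k2 (z + v2)]].

Definition local_utility (z : 'rV[R]_m) (b : R) : R :=
  maximum [set t | exists k1 k2 : 'I_K,
    (k1 < k2)%N /\ t = pair_utility z k1 k2 b].

Definition local_growth (nrm : 'rV[R]_m -> R) (z : 'rV[R]_m) : R :=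
  maximum [set maximum [set dual_norm nrm xi
                       | xi in superdifferential (ell k) z]
          | k in [set: 'I_K]].

End LocalProblems.

(* Main.v *)
(* Feasible mixtures for the budget [b] are contracted towards [z = zhat i]:
   with [t = b' / b <= 1], replacing each [z + v_j] by [z + t v_j] multiplies
   its cost by at most [t] (convexity of the cost, which vanishes on the
   diagonal), so the result is feasible for [b'].  Concavity and a supergradient
   at [z] bound the loss by [(1 - t) G sum_j alpha_j |v_j|], and Jensen's
   inequality with [c >= |.|^p] bounds this by
   [(1 - t) G b^(1/p) <= G (b - b')^(1/p)].

   All the maxima have to be attained.  When a weight [alpha_j] tends to 0 the
   point [z + v_j] may escape to infinity, but since [ell_k] grows sublinearly
   with respect to the cost ([p > 1], or the growth condition if [p = 1]) its
   contribution vanishes: the supremum is reached either at a degenerate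
   mixture or over weights in a segment [[d, 1 - d]], where compactness applies.

   Supergradients of a concave function on R^m are obtained by a Hahn-Banach
   extension, one coordinate at a time. *)

Require Import Defs.
From mathcomp Require Import all_boot all_order all_algebra.
From mathcomp Require Import all_classical all_reals all_analysis.
From mathcomp Require Import ring lra.

Set Implicit Arguments.
Unset Strict Implicit.
Unset Printing Implicit Defensive.

Import Order.TTheory GRing.Theory Num.Theory.
Import numFieldNormedType.Exports.

Local Open Scope classical_set_scope.
Local Open Scope ring_scope.

Lemma finite_max (R : realDomainType) (I : finType) (P : pred I) (F : I -> R) :
  (exists i, P i) -> exists2 i, P i & forall j, P j -> F j <= F i.
Proof.
by move=> [i0 Pi0]; case: (@arg_maxP _ _ _ i0 P F Pi0) => i; exists i.
Qed.

(** * Concave functions and supergradients *)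

Section Convexity.
Variables (R : realType) (m : nat).
Implicit Types (f : 'rV[R]_m -> R) (v w x y z xi : 'rV[R]_m) (s t : R).

Lemma convex_set_comb (Z : set 'rV[R]_m) x y t :
  convex_set (Z : set (convex_lmodType 'rV[R]_m)) -> Z x -> Z y ->
  0 <= t <= 1 -> Z (t *: x + (1 - t) *: y).
Proof.
move=> cZ Zx Zy t01; have := cZ x y (Itv01 (andP t01).1 (andP t01).2).
by rewrite !inE; apply.
Qed.

Lemma convex_function_comb (Z : set 'rV[R]_m) f x y t :
  convex_function (Z : set (convex_lmodType 'rV[R]_m)) f -> Z x -> Z y ->
  0 <= t <= 1 -> f (t *: x + (1 - t) *: y) <= t * f x + (1 - t) * f y.
Proof.
move=> cf Zx Zy t01; have := cf (Itv01 (andP t01).1 (andP t01).2) x y.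
by rewrite !inE; apply.
Qed.

Lemma concave_function_comb f x y t : concave_function setT f ->
  0 <= t <= 1 -> t * f x + (1 - t) * f y <= f (t *: x + (1 - t) *: y).
Proof.
move=> cf t01; have := convex_function_comb cf I I t01 (x := x) (y := y).
by lra.
Qed.

Lemma innerDl x y z : inner (x + y) z = inner x z + inner y z :> R.
Proof. by rewrite -big_split; apply: eq_bigr => i _; rewrite mxE mulrDl. Qed.

Lemma innerDr x y z : inner z (x + y) = inner z x + inner z y :> R.
Proof. by rewrite -big_split; apply: eq_bigr => i _; rewrite mxE mulrDr. Qed.

Lemma innerZl t x z : inner (t *: x) z = t * inner x z.
Proof. by rewrite mulr_sumr; apply: eq_bigr => i _; rewrite mxE mulrA. Qed.

Lemma innerZr t x z : inner z (t *: x) = t * inner z x.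
Proof. by rewrite mulr_sumr; apply: eq_bigr => i _; rewrite mxE mulrCA. Qed.

Lemma innerNr x z : inner z (- x) = - inner z x.
Proof. by rewrite -scaleN1r innerZr mulN1r. Qed.

Lemma inner_delta x j : inner (delta_mx 0 j) x = x 0 j.
Proof.
rewrite /inner (bigD1 j)//= !mxE !eqxx mul1r big1 ?addr0// => i ij.
by rewrite mxE (negbTE ij) andbF mul0r.
Qed.

Lemma innerC x y : inner x y = inner y x.
Proof. by apply: eq_bigr => i _; rewrite mulrC. Qed.

Lemma concave_interpolate f x y s t : concave_function setT f ->
  0 < s -> 0 < t ->
  s * f x + t * f y <= (s + t) * f ((s + t)^-1 *: (s *: x + t *: y)).
Proof.
move=> cf s0 t0; have st0 : 0 < s + t by rewrite addr_gt0.
have s01 : 0 <= s / (s + t) <= 1.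
  by rewrite divr_ge0 ?(ltW s0) ?(ltW st0)//= ler_pdivrMr// mul1r lerDl ltW.
have st1 : 1 - s / (s + t) = t / (s + t) by field; rewrite gt_eqF.
have := concave_function_comb x y cf s01; rewrite st1.
rewrite -(ler_pM2l st0) mulrDr scalerDr !scalerA !(mulrC _ (s + t)^-1).
by rewrite !mulrA mulfV ?gt_eqF// !mul1r.
Qed.

(* One Hahn-Banach step: the admissible slopes in direction [j] form a nonempty
   interval because the difference quotients from the right stay below those
   from the left. *)
Lemma support_step f xi (k : nat) (j : 'I_m) :
  (forall x y s t, 0 < s -> 0 < t ->
    s * f x + t * f y <= (s + t) * f ((s + t)^-1 *: (s *: x + t *: y))) ->
  k = j ->
  (forall w, (forall i : 'I_m, (k <= i)%N -> w 0 i = 0) -> f w <= inner xi w) ->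
  exists xi', forall w,
    (forall i : 'I_m, (k.+1 <= i)%N -> w 0 i = 0) -> f w <= inner xi' w.
Proof.
move=> cf kj fxi; pose e : 'rV[R]_m := delta_mx 0 j.
pose V := [set w : 'rV[R]_m | forall i : 'I_m, (k <= i)%N -> w 0 i = 0].
pose q s w := (f (w + s *: e) - inner xi w) / s.
pose S := [set q s w | s in [set s | 0 < s] & w in V].
have V0 : V 0 by move=> i _; rewrite mxE.
have Vcomb s t w v : V w -> V v -> V (s *: w + t *: v).
  by move=> Vw Vv i ki; rewrite !mxE Vw// Vv// !mulr0 addr0.
have quot s t w v : 0 < s -> 0 < t -> V w -> V v ->
    q s w <= (inner xi v - f (v - t *: e)) / t.
  move=> s0 t0 Vw Vv; rewrite /q ler_pdivrMr// mulrAC ler_pdivlMr//.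
  have wv : t *: (w + s *: e) + s *: (v - t *: e) = t *: w + s *: v.
    by rewrite !scalerDr scalerN !scalerA (mulrC t s) addrACA subrr addr0.
  have := cf (w + s *: e) (v - t *: e) t s t0 s0; rewrite wv => le1.
  have Vu : V ((t + s)^-1 *: (t *: w + s *: v)).
    by rewrite scalerDr !scalerA; apply: Vcomb.
  have := fxi _ Vu.
  have st0 : 0 < t + s by rewrite addr_gt0.
  rewrite -(ler_pM2l st0) innerZr innerDr !innerZr mulrA mulfV ?gt_eqF// mul1r.
  by move=> le2; have := le_trans le1 le2; lra.
have S0 : S !=set0 by exists (q 1 0), 1; [exact: ltr01|exists 0].
have ubS t v : 0 < t -> V v -> ubound S ((inner xi v - f (v - t *: e)) / t).
  by move=> t0 Vv _ [s s0 [w Vw <-]]; apply: quot.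
have hS : has_sup S.
  by split=> //; exists ((inner xi 0 - f (0 - 1 *: e)) / 1); apply: ubS.
exists (xi + (sup S - inner xi e) *: e) => w Vw.
pose s := w 0 j; pose v := w - s *: e.
have Vv : V v.
  move=> i; rewrite leq_eqVlt => /orP[/eqP ki|ki].
    have -> : i = j by apply/val_inj; rewrite /= -ki.
    by rewrite !mxE !eqxx mulr1 subrr.
  rewrite !mxE Vw// (_ : i == j = false) ?andbF ?mulr0 ?subr0//.
  by apply/negbTE; apply: contraTneq ki => ->; rewrite kj ltnn.
have wE : w = v + s *: e by rewrite subrK.
rewrite innerDl innerZl inner_delta -/s.
have -> : inner xi w = inner xi v + s * inner xi e.
  by rewrite {1}wE innerDr innerZr.
suff : f w - inner xi v <= s * sup S by lra.
have [s0|s0|s0] := ltgtP s 0; last first.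
- rewrite s0 mul0r subr_le0 wE s0 scale0r addr0; exact: fxi.
- rewrite mulrC -ler_pdivrMr// {1}wE; apply: ub_le_sup; first exact: hS.2.
  by exists s => //; exists v.
- have : sup S <= (inner xi v - f (v - (- s) *: e)) / (- s).
    by apply: ge_sup => //; apply: ubS => //; rewrite oppr_gt0.
  rewrite ler_pdivlMr ?oppr_gt0// scaleNr opprK -wE; lra.
Qed.

Lemma superdifferential_nonempty f z : concave_function setT f ->
  superdifferential f z !=set0.
Proof.
move=> cf; pose h w := f (z + w) - f z.
have ch x y s t : 0 < s -> 0 < t ->
    s * h x + t * h y <= (s + t) * h ((s + t)^-1 *: (s *: x + t *: y)).
  move=> s0 t0.
  have := concave_interpolate (z + x) (z + y) cf s0 t0.
  have -> : (s + t)^-1 *: (s *: (z + x) + t *: (z + y)) =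
      z + (s + t)^-1 *: (s *: x + t *: y).
    rewrite (scalerDr s) (scalerDr t) addrACA -scalerDl scalerDr scalerA.
    by rewrite mulVf ?scale1r// gt_eqF// addr_gt0.
  by rewrite /h; lra.
have h0 : h 0 = 0 by rewrite /h addr0 subrr.
have H (k : nat) : (k <= m)%N -> exists xi, forall w,
    (forall i : 'I_m, (k <= i)%N -> w 0 i = 0) -> h w <= inner xi w.
  elim: k => [_|k IH km].
    exists 0 => w w0; have -> : w = 0 by apply/rowP => i; rewrite w0// mxE.
    by rewrite h0 /inner big1// => i _; rewrite mxE mul0r.
  have [xi hxi] := IH (ltnW km).
  exact: (@support_step h xi k (Ordinal km)).
have [xi hxi] := H m (leqnn _); exists xi => w.
have := hxi (w - z); rewrite /h addrCA subrr addr0 => /(_ _).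
rewrite lerBlDl; apply => i; by rewrite leqNgt ltn_ord.
Qed.

End Convexity.

(** * Norms on R^m and their duals *)

Lemma compact_majorant_max (T : topologicalType) (R : realType)
    (A : set T) (f : T -> R) : A !=set0 -> compact A ->
  (forall x, A x -> exists h : T -> R,
    [/\ {for x, continuous h}, h x = f x & forall y, A y -> f y <= h y]) ->
  exists2 c, A c & forall y, A y -> f y <= f c.
Proof.
move=> A0 cA fh; apply: contrapT => nmax.
have above x : A x -> exists2 y, A y & f x < f y.
  move=> Ax; apply: contrapT => nx; apply: nmax; exists x => // y Ay.
  by rewrite leNgt; apply/negP => xy; apply: nx; exists y.
(* The superlevel sets [f >= f a] form a filter base; at a cluster point the
   majorant would be smaller than some [f y] and so violate [f y <= f]. *)
pose F : set_system T :=
  [set U | exists2 a, A a & forall y, A y -> f a <= f y -> U y].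
have PF : ProperFilter F.
  split.
    by move=> [a Aa /(_ a Aa (lexx _))].
  split.
  - by case: A0 => a Aa; exists a.
  - move=> U V [a Aa aU] [a' Aa' aV].
    have [aa'|a'a] := leP (f a) (f a').
      exists a' => // y Ay a'y; split; [apply: aU => //|exact: aV].
      exact: le_trans a'y.
    exists a => // y Ay ay; split; [exact: aU|apply: aV => //].
    exact: le_trans (ltW a'a) ay.
  - by move=> U V UV [a Aa aU]; exists a => // y Ay /(aU _ Ay)/UV.
have [|x [Ax clx]] := cA F PF.
  by case: A0 => a Aa; exists a.
have [h [hc hx fh']] := fh x Ax.
have [y Ay xy] := above x Ax.
have Fy : F [set u | A u /\ f y <= f u] by exists y.
have near_x : \forall u \near x, h u < f y.
  by apply: (cvgr_lt (h x)) => //; rewrite hx.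
have [u [[Au yu]]] := clx _ _ Fy near_x.
by rewrite /= ltNge (le_trans yu (fh' u Au)).
Qed.

Section Norms.
Variables (R : realType) (m : nat) (nrm : 'rV[R]_m -> R).
Implicit Types (f : 'rV[R]_m -> R) (v w x y z xi : 'rV[R]_m) (r s t : R).
Hypothesis hn : is_norm nrm.

Lemma is_norm0 : nrm 0 = 0.
Proof. by case: hn => _ nZ _; rewrite -(scale0r 0) nZ normr0 mul0r. Qed.

Lemma is_normN v : nrm (- v) = nrm v.
Proof. by case: hn => _ nZ _; rewrite -scaleN1r nZ normrN normr1 mul1r. Qed.

Lemma is_norm_ge0 v : 0 <= nrm v.
Proof.
case: hn => nD _ _; have := nD v (- v).
by rewrite subrr is_norm0 is_normN; lra.
Qed.

Lemma norm_le_mx_norm : exists2 C : R, 0 <= C & forall v, nrm v <= C * `|v|.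
Proof.
case: hn => nD nZ _; exists (\sum_(j < m) nrm (delta_mx 0 j)).
  by apply: sumr_ge0 => j _; apply: is_norm_ge0.
move=> v; have nS (I : Type) (r : seq I) (F : I -> 'rV[R]_m) :
    nrm (\sum_(j <- r) F j) <= \sum_(j <- r) nrm (F j).
  elim/big_ind2 : _ => //; first by rewrite is_norm0.
  by move=> a b a' b' ab a'b'; apply: le_trans (nD _ _) (lerD ab a'b').
rewrite {1}[v]row_sum_delta (le_trans (nS _ _ _))// mulr_suml.
apply: ler_sum => j _; rewrite nZ mulrC ler_wpM2l ?is_norm_ge0//.
rewrite [leRHS]/Num.norm /= mx_normrE; apply/bigmax_geP; right => /=.
by exists (0, j).
Qed.

Lemma is_norm_continuous : continuous nrm.
Proof.
have [C C0 nC] := norm_le_mx_norm; case: hn => nD _ _.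
have lip v w : nrm v - nrm w <= C * `|v - w|.
  by have := nD (v - w) w; rewrite subrK; have := nC (v - w); lra.
have C1 : 0 < C + 1 by rewrite ltr_wpDl.
move=> v; apply/(@cvgrPdist_le _ _ _ (nbhs v) (nbhs_filter v)) => e e0.
apply/nbhs_ballP.
exists (e / (C + 1)); first by rewrite /= divr_gt0.
move=> w; rewrite -ball_normE /= => /ltW vw.
apply: (@le_trans _ _ (C * `|v - w|)).
  by rewrite ler_norml lip lerNl opprB distrC lip.
apply: (@le_trans _ _ ((C + 1) * `|v - w|)).
  by rewrite ler_wpM2r// lerDl.
by rewrite mulrC -ler_pdivlMr.
Qed.

Lemma mx_norm_le_norm : exists2 k : R, 0 < k & forall v, k * `|v| <= nrm v.
Proof.
case: (hn) => _ nZ n0.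
pose S := [set v : 'rV[R]_m | `|v| = 1].
have cS : compact S.
  apply: bounded_closed_compact.
    by exists 1; split=> // M M1 v /= ->; exact: ltW.
  apply: (@preimage_closed _ _ (fun v : 'rV[R]_m => `|v|) [set 1]).
    by move=> v _; exact: norm_continuous.
  exact: closed_eq.
have scale v : v != 0 -> S (`|v|^-1 *: v).
  move=> v0; rewrite /S /= normrZ normfV normr_id mulVf//.
  by rewrite normr_eq0.
have [S0|/set0P S0] := eqVneq S set0.
  exists 1 => // v; have [->|/scale] := eqVneq v 0; last by rewrite S0.
  by rewrite normr0 mulr0 is_norm_ge0.
have [|v0] := compact_EVT_min S0 cS (f := nrm).
  by apply: continuous_subspaceT; exact: is_norm_continuous.
rewrite inE => Sv0 nv0; exists (nrm v0).
  rewrite lt_def is_norm_ge0 andbT; apply/eqP => /n0 v00.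
  by move: Sv0; rewrite /S /= v00 normr0 => /eqP; rewrite eq_sym oner_eq0.
move=> v; have [->|v1] := eqVneq v 0; first by rewrite normr0 mulr0 is_norm_ge0.
have := nv0 _ (mem_set (scale v v1)); rewrite nZ normfV normr_id.
by rewrite ler_pdivlMl ?normr_gt0// mulrC.
Qed.

Lemma norm_ball_compact r : compact [set w | nrm w <= r].
Proof.
have [k k0 kn] := mx_norm_le_norm; apply: bounded_closed_compact.
  exists (k^-1 * r); split; first exact: num_real.
  move=> M /ltW rM v /= vr; apply: le_trans rM.
  by rewrite ler_pdivlMl// (le_trans (kn _)).
apply: (@preimage_closed _ _ nrm [set x | x <= r]) => [v _|].
  exact: is_norm_continuous.
exact: closed_le.
Qed.

Lemma inner_continuous :
  continuous (fun y : 'rV[R]_m * 'rV[R]_m => inner y.1 y.2).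
Proof.
apply: continuous_big => [|j _ y]; first exact: add_continuous.
apply: cvgM.
    by apply: (@continuous_comp _ _ _ fst (fun v : 'rV[R]_m => v 0 j));
      [exact: cvg_fst|exact: coord_continuous].
  by apply: (@continuous_comp _ _ _ snd (fun v : 'rV[R]_m => v 0 j));
    [exact: cvg_snd|exact: coord_continuous].
Qed.

Lemma norm_ball_nonempty : [set v | nrm v <= 1] !=set0.
Proof. by exists 0; rewrite /= is_norm0. Qed.

Lemma inner_continuousr xi : continuous (inner xi).
Proof.
apply: continuous_big => [|j _ v]; first exact: add_continuous.
apply: (@continuousM _ _ (fun=> xi 0 j) (fun w : 'rV[R]_m => w 0 j)).
  exact: cst_continuous.
exact: coord_continuous.
Qed.

Lemma dual_norm_attained xi : exists v, [/\ nrm v <= 1,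
  dual_norm nrm xi = inner xi v &
  forall w, nrm w <= 1 -> inner xi w <= dual_norm nrm xi].
Proof.
have [|v] := compact_EVT_max norm_ball_nonempty (norm_ball_compact (r := 1))
    (f := inner xi).
  by apply: continuous_subspaceT; exact: inner_continuousr.
rewrite inE => v1 vmax.
have ub w : nrm w <= 1 -> inner xi w <= inner xi v.
  by move=> w1; apply: vmax; rewrite inE.
have -> : dual_norm nrm xi = inner xi v.
  apply/eqP; rewrite eq_le; apply/andP; split.
    apply: ge_sup; first by exists (inner xi v), v.
    by move=> _ [w w1 <-]; apply: ub.
  apply: ub_le_sup; last by exists v.
  by exists (inner xi v) => _ [w w1 <-]; apply: ub.
by exists v.
Qed.

Lemma inner_le_dual_norm xi v : inner xi v <= dual_norm nrm xi * nrm v.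
Proof.
have [w [_ _ ub]] := dual_norm_attained xi; case: (hn) => _ nZ n0.
have [v0|v0] := eqVneq (nrm v) 0.
  by rewrite v0 mulr0 (n0 _ v0) /inner big1// => j _; rewrite mxE mulr0.
have v_gt0 : 0 < nrm v by rewrite lt_def v0 is_norm_ge0.
rewrite mulrC -ler_pdivrMl// -innerZr; apply: ub.
by rewrite nZ gtr0_norm ?invr_gt0// mulVf.
Qed.

Lemma superdifferential_compact f z : compact (superdifferential f z).
Proof.
apply: bounded_closed_compact.
  pose B j := `|f (z + delta_mx 0 j) - f z| + `|f (z - delta_mx 0 j) - f z|.
  have B0 j : 0 <= B j by rewrite addr_ge0.
  exists (\sum_j B j); split; first exact: num_real.
  move=> M /ltW BM xi xif /=; apply: le_trans BM.
  rewrite [leLHS]/Num.norm /= mx_normrE; apply: bigmax_le.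
    by apply: sumr_ge0.
  move=> [i j] _ /=; rewrite (ord1 i) (@le_trans _ _ (B j))//.
    have := xif (z + delta_mx 0 j); have := xif (z - delta_mx 0 j).
    rewrite !(addrAC z _ (- z)) subrr !add0r innerNr [inner xi _]innerC.
    rewrite inner_delta /B => le1 le2; rewrite ler_norml.
    have := ler_norm (f (z + delta_mx 0 j) - f z).
    have := ler_norm (- (f (z + delta_mx 0 j) - f z)).
    have := ler_norm (f (z - delta_mx 0 j) - f z).
    have := ler_norm (- (f (z - delta_mx 0 j) - f z)).
    rewrite !normrN; lra.
  by rewrite (bigD1 j)//= lerDl sumr_ge0.
rewrite (_ : superdifferential f z =
    \bigcap_w [set xi | f w - f z <= inner xi (w - z)]); last first.
  apply/seteqP; split=> xi xif w; first by move=> _; rewrite /= lerBlDl.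
  by rewrite -lerBlDl; apply: xif.
apply: closed_bigI => w _.
apply: (@preimage_closed _ _ (fun xi => inner xi (w - z))
  [set t | f w - f z <= t]); last exact: closed_ge.
have -> : (fun xi => inner xi (w - z)) = inner (w - z).
  by apply/funext => xi; rewrite innerC.
by move=> xi _; exact: inner_continuousr.
Qed.

Lemma dual_norm_superdifferential_max f z : concave_function setT f ->
  exists2 xi, superdifferential f z xi &
    forall xi', superdifferential f z xi' ->
    dual_norm nrm xi' <= dual_norm nrm xi.
Proof.
move=> /(superdifferential_nonempty z)[xi0 Sxi0].
pose B := superdifferential f z `*` [set v | nrm v <= 1].
have B0 : B !=set0 by exists (xi0, 0); split=> //=; rewrite is_norm0.
have cB : compact B.
  apply: compact_setX; first exact: superdifferential_compact.
  exact: norm_ball_compact.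
have [|[xi v]] := compact_EVT_max B0 cB (f := fun u => inner u.1 u.2).
  by apply: continuous_subspaceT; exact: inner_continuous.
rewrite inE => -[/= Sxi v1] ximax; exists xi => // xi' Sxi'.
have [v' [v'1 -> _]] := dual_norm_attained xi'.
have [_ [_ _ ub]] := dual_norm_attained xi.
apply: le_trans (ub _ v1).
by have := ximax (xi', v'); rewrite inE; apply.
Qed.

End Norms.

Section PowerBounds.
Variable R : realType.
Implicit Types a p r t x y : R.

Lemma powR_sublinear r p eta : 0 <= r < p -> 0 < eta ->
  exists M, forall y, 0 <= y -> y `^ r <= M + eta * y `^ p.
Proof.
move=> /andP[r0 rp] eta0; have pr0 : 0 < p - r by rewrite subr_gt0.
pose T := eta^-1 `^ (p - r)^-1.
have T0 : 0 < T by rewrite powR_gt0 ?invr_gt0.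
exists (T `^ r) => y y0; have [yT|Ty] := leP y T.
  rewrite (@le_trans _ _ (T `^ r))//; last first.
    by rewrite lerDl mulr_ge0 ?powR_ge0// ltW.
  by apply: ge0_ler_powR; rewrite ?nnegrE// ltW.
have y_gt0 := lt_trans T0 Ty.
rewrite (@le_trans _ _ (eta * y `^ p))//; last by rewrite lerDr powR_ge0.
have -> : p = r + (p - r) by rewrite addrC subrK.
rewrite powRD; last by rewrite (gt_eqF y_gt0) implybT.
rewrite mulrCA ler_peMr ?powR_ge0//.
have -> : 1 = eta * T `^ (p - r).
  rewrite /T -powRrM mulVf ?gt_eqF// powRr1 ?invr_ge0 ?ltW//.
  by rewrite mulfV// gt_eqF.
rewrite ler_pM2l//; apply: ge0_ler_powR; rewrite ?nnegrE// ltW//.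
Qed.

Lemma mean_le_root p a x y t : 1 <= p -> 0 <= a <= 1 -> 0 <= x -> 0 <= y ->
  a * x `^ p + (1 - a) * y `^ p <= t -> a * x + (1 - a) * y <= t `^ p^-1.
Proof.
move=> p1 /andP[a0 a1] x0 y0 xyt; have p0 : 0 < p by exact: lt_le_trans p1.
have a1' : 0 <= 1 - a by rewrite subr_ge0.
have xy0 : 0 <= a * x + (1 - a) * y by rewrite addr_ge0// mulr_ge0.
have xyp : (a * x + (1 - a) * y) `^ p <= a * x `^ p + (1 - a) * y `^ p.
  by apply: (convex_powR p1 (Itv01 a0 a1)); rewrite inE/= in_itv/= ?x0 ?y0.
have -> : a * x + (1 - a) * y = ((a * x + (1 - a) * y) `^ p) `^ p^-1.
  by rewrite -powRrM mulfV ?gt_eqF// powRr1.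
have xyt' := le_trans xyp xyt.
apply: ge0_ler_powR => //; rewrite ?nnegrE ?invr_ge0 ?(ltW p0) ?powR_ge0//.
exact: le_trans (powR_ge0 _ _) xyt'.
Qed.

Lemma le_powR_root p a : 1 <= p -> 0 <= a <= 1 -> a <= a `^ p^-1.
Proof.
move=> p1 /andP[]; rewrite le_eqVlt => /predU1P[<- _|a0 a1].
  exact: powR_ge0.
by rewrite ger1_powR ?a0// invf_le1// (lt_le_trans _ p1).
Qed.

End PowerBounds.

(** * Attainment of the pair utility *)

Definition pair_feasible (R : realType) (m : nat) (Z : set 'rV[R]_m)
    (g : 'rV[R]_m -> R) (b a : R) (w1 w2 : 'rV[R]_m) : Prop :=
  [/\ 0 <= a <= 1, Z w1, Z w2 & a * g w1 + (1 - a) * g w2 <= b].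

Section Attainment.
Variables (R : realType) (m : nat).
Implicit Types (f : 'rV[R]_m -> R) (v w x y z xi : 'rV[R]_m) (b r s t : R).
Variables (Z : set 'rV[R]_m) (c : 'rV[R]_m -> 'rV[R]_m -> R).
Hypotheses (hc : transport_cost Z c) (closedZ : closed Z).

Lemma epigraph_closed z : Z z ->
  closed [set u : 'rV[R]_m * R | Z u.1 /\ c u.1 z <= u.2].
Proof.
move=> Zz; rewrite closedE => -[w t] /= nn; apply: contrapT => nE; apply: nn.
have [Zw|nZw] := pselect (Z w); last first.
  have nearw : nbhs w (~` Z).
    by apply: open_nbhs_nbhs; split=> //; exact: closed_openC.
  have := @cvg_fst _ _ (nbhs w) (nbhs t) (nbhs_filter t) _ nearw.
  apply: (@filterS _ (nbhs (w, t)) (nbhs_filter (w, t))).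
  by move=> [w' t'] /= nZ' [].
have tc : t < c w z by rewrite ltNge; apply/negP => ct; apply: nE.
pose s := (t + c w z) / 2.
have sc : (s%:E < (c w z)%:E)%E by rewrite lte_fin /s; lra.
have [V + sV] := cost_lsc hc (x := (w, z)) sc.
change (nbhs_subspace (A := Z `*` Z) (w, z) V ->
  \forall p \near (w, t), ~ (Z p.1 /\ c p.1 z <= p.2)).
rewrite -nbhs_subspace_in// => nV.
have nw : nbhs w [set w' | Z w' -> V (w', z)].
  have wz : (fun w' : 'rV[R]_m => (w', z)) @ w --> (w, z).
    apply: (@cvg_pair _ _ _ (nbhs w) (nbhs w) (nbhs z)).
      exact: cvg_id.
    exact: (@cvg_cst _ _ _ (nbhs w) (nbhs_filter w)).
  have := wz _ nV; apply: (@filterS _ (nbhs w) (nbhs_filter w)).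
  by move=> w' /= ZV Zw'; exact: ZV.
have := @cvg_fst _ _ (nbhs w) (nbhs t) (nbhs_filter t) _ nw.
have nt : nbhs t [set t' | t' < s] by apply: lt_nbhsl; rewrite /s; lra.
have := @cvg_snd _ _ (nbhs w) (nbhs t) (nbhs_filter w) _ nt.
apply: (@filterS2 _ (nbhs (w, t)) (nbhs_filter (w, t))).
move=> [w' t'] /= t's ZV [Zw' ct'].
have := sV _ (ZV Zw'); rewrite /= lte_fin; lra.
Qed.

Variables (nrm : 'rV[R]_m -> R) (p : R).
Hypotheses (hn : is_norm nrm) (p1 : 1 <= p).
Hypothesis cost_ge :
  forall z w, Z z -> Z w -> nrm (z - w) `^ p <= c z w.

Lemma norm_le_cost_root z w : Z z -> Z w -> nrm (z - w) <= c z w `^ p^-1.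
Proof.
move=> Zz Zw; have p0 : 0 < p by exact: lt_le_trans p1.
have n0 := is_norm_ge0 hn (z - w).
rewrite -[leLHS]powRr1// -(mulfV (lt0r_neq0 p0)) powRrM.
apply: ge0_ler_powR; rewrite ?invr_ge0 ?(ltW p0) ?nnegrE ?powR_ge0//.
  exact: cost_ge0 hc _ _ Zz Zw.
exact: cost_ge.
Qed.

Lemma epigraph_compact z t : Z z -> compact
  [set u : 'rV[R]_m * R | [/\ Z u.1, c u.1 z <= u.2 & u.2 <= t]].
Proof.
move=> Zz.
have cB : compact ((fun v => v + z) @` [set v | nrm v <= t `^ p^-1]).
  apply: continuous_compact; last exact: norm_ball_compact.
  apply: continuous_subspaceT => v.
  apply: (@cvgD _ _ _ (nbhs v)); first exact: cvg_id.
  exact: (@cvg_cst _ _ _ (nbhs v) (nbhs_filter v)).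
apply: (@subclosed_compact _ _ (_ `*` `[0, t]%classic)); last 2 first.
- exact: compact_setX cB (@segment_compact _ 0 t).
- move=> [w s] /= [Zw ws st]; have w0 := cost_ge0 hc Zw Zz.
  split=> /=; last by rewrite in_itv/= (le_trans w0 ws).
  exists (w - z); last by rewrite subrK.
  rewrite /= (le_trans (norm_le_cost_root Zw Zz))//.
  apply: ge0_ler_powR; rewrite ?nnegrE ?invr_ge0//.
  + by rewrite (le_trans _ p1).
  + by rewrite (le_trans w0)// (le_trans ws).
  + exact: le_trans ws st.
rewrite (_ : [set u | _] = [set u : 'rV[R]_m * R | Z u.1 /\ c u.1 z <= u.2]
    `&` snd @^-1` [set s | s <= t]).
  apply: closedI; first exact: epigraph_closed.
  apply: preimage_closed; last exact: closed_le.
  by move=> u _; exact: cvg_snd.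
apply/seteqP; split=> u /=; first by case.
by move=> [[]].
Qed.

Lemma affine_continuous xi x r : continuous (fun w => r + inner xi (w - x)).
Proof.
move=> w; apply: (@cvgD _ _ _ (nbhs w)).
  exact: (@cvg_cst _ _ _ (nbhs w) (nbhs_filter w)).
apply: (@continuous_comp _ _ _ (fun w => w - x) (inner xi)).
  apply: (@cvgB _ _ _ (nbhs w)); first exact: cvg_id.
  exact: (@cvg_cst _ _ _ (nbhs w) (nbhs_filter w)).
exact: inner_continuousr.
Qed.

Lemma budget_max f z b : concave_function setT f -> Z z -> 0 <= b ->
  exists w, [/\ Z w, c w z <= b &
    forall w', Z w' -> c w' z <= b -> f w' <= f w].
Proof.
move=> cf Zz b0.
have [||[w t] /= [Zw wt tb] wmax] :=
    compact_majorant_max (f := fun u => f u.1) _ (epigraph_compact (t := b) Zz).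
- by exists (z, b); split; rewrite //= (cost_diag hc Zz).
- move=> [w t] /= _; have [xi hxi] := superdifferential_nonempty w cf.
  exists (fun u => f w + inner xi (u.1 - w)); split=> /=.
  + move=> u.
    apply: (@continuous_comp _ _ _ fst (fun v => f w + inner xi (v - w))).
      exact: cvg_fst.
    exact: affine_continuous.
  + by rewrite subrr /inner big1 ?addr0// => j _; rewrite mxE mulr0.
  + by move=> u _; exact: hxi.
exists w; split=> //; first exact: le_trans wt tb.
by move=> w' Zw' w'b; apply: (wmax (w', b)).
Qed.

Lemma interior_pair_max f1 f2 z b d a0 v1 v2 :
  concave_function setT f1 -> concave_function setT f2 -> Z z -> 0 < d ->
  d <= a0 <= 1 - d -> pair_feasible Z (c^~ z) b a0 v1 v2 ->
  exists a w1 w2, pair_feasible Z (c^~ z) b a w1 w2 /\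
    forall a' w1' w2', d <= a' <= 1 - d ->
      pair_feasible Z (c^~ z) b a' w1' w2' ->
      a' * f1 w1' + (1 - a') * f2 w2' <= a * f1 w1 + (1 - a) * f2 w2.
Proof.
move=> cf1 cf2 Zz d0 a0d feas0.
pose E := [set u : 'rV[R]_m * R | [/\ Z u.1, c u.1 z <= u.2 & u.2 <= b / d]].
have cE : compact E by exact: epigraph_compact.
(* Upper bounds [t1], [t2] of the costs are carried along: the epigraph of a
   lower semicontinuous cost is closed, but the cost need not be continuous. *)
pose P := (R * (('rV[R]_m * R) * ('rV[R]_m * R)))%type.
have ca : continuous (fun u : P => u.1) by move=> u; exact: cvg_fst.
have c2 : continuous (fun u : P => u.2) by move=> u; exact: cvg_snd.
have c21 : continuous (fun u : P => u.2.1).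
  by move=> u; apply: (continuous_comp (c2 u)); exact: cvg_fst.
have c22 : continuous (fun u : P => u.2.2).
  by move=> u; apply: (continuous_comp (c2 u)); exact: cvg_snd.
have cw1 : continuous (fun u : P => u.2.1.1).
  by move=> u; apply: (continuous_comp (c21 u)); exact: cvg_fst.
have ct1 : continuous (fun u : P => u.2.1.2).
  by move=> u; apply: (continuous_comp (c21 u)); exact: cvg_snd.
have cw2 : continuous (fun u : P => u.2.2.1).
  by move=> u; apply: (continuous_comp (c22 u)); exact: cvg_fst.
have ct2 : continuous (fun u : P => u.2.2.2).
  by move=> u; apply: (continuous_comp (c22 u)); exact: cvg_snd.
have mix (k1 k2 : P -> R) : continuous k1 -> continuous k2 ->
    continuous (fun u : P => u.1 * k1 u + (1 - u.1) * k2 u).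
  move=> ck1 ck2 u; apply: cvgD.
    by apply: cvgM; [exact: ca|exact: ck1].
  apply: cvgM; last exact: ck2.
  by apply: cvgB; [exact: cvg_cst|exact: ca].
pose A := [set u : P | [/\ d <= u.1 <= 1 - d, E u.2.1, E u.2.2 &
  u.1 * u.2.1.2 + (1 - u.1) * u.2.2.2 <= b]].
have feasA a w1 w2 : d <= a <= 1 - d -> pair_feasible Z (c^~ z) b a w1 w2 ->
    A (a, ((w1, c w1 z), (w2, c w2 z))).
  move=> /andP[da ad] [_ Zw1 Zw2 wb].
  have [g1 g2] := (cost_ge0 hc Zw1 Zz, cost_ge0 hc Zw2 Zz).
  split=> //=; first by rewrite da.
    split=> //=; rewrite ler_pdivlMr// mulrC; apply: le_trans wb.
    by rewrite (le_trans (ler_wpM2r g1 da))// lerDl mulr_ge0//; lra.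
  split=> //=; rewrite ler_pdivlMr// mulrC; apply: le_trans wb.
  have da' : d <= 1 - a by lra.
  by rewrite (le_trans (ler_wpM2r g2 da'))// lerDr mulr_ge0//; lra.
have cA : compact A.
  apply: (@subclosed_compact _ _
    ((`[d, 1 - d]%classic `*` (E `*` E)) : set P)); last 2 first.
  - apply: compact_setX; first exact: segment_compact.
    exact: compact_setX.
  - by move=> u [du E1 E2 _]; split=> //=; rewrite in_itv.
  have clE : closed E.
    by apply: compact_closed => //; exact: norm_hausdorff.
  rewrite (_ : A = (fun u => u.1) @^-1` `[d, 1 - d]%classic `&`
    ((fun u => u.2.1) @^-1` E `&` ((fun u => u.2.2) @^-1` E `&`
    (fun u => u.1 * u.2.1.2 + (1 - u.1) * u.2.2.2) @^-1` [set t | t <= b]))).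
    apply: closedI.
      by apply: preimage_closed; [move=> u _; exact: ca|exact: interval_closed].
    apply: closedI; first by apply: preimage_closed => // u _; exact: c21.
    apply: closedI; first by apply: preimage_closed => // u _; exact: c22.
    apply: preimage_closed; last exact: closed_le.
    by move=> u _; exact: mix.
  apply/seteqP; split=> u /=; rewrite in_itv/=; first by case.
  by move=> [? [? []]].
have [||[a [[w1 t1] [w2 t2]]] /= Aw wmax] := compact_majorant_max
    (f := fun u : P => u.1 * f1 u.2.1.1 + (1 - u.1) * f2 u.2.2.1) _ cA.
- by exists (a0, ((v1, c v1 z), (v2, c v2 z))); exact: feasA.
- move=> [a [[w1 t1] [w2 t2]]] /= _.
  have [xi1 hxi1] := superdifferential_nonempty w1 cf1.
  have [xi2 hxi2] := superdifferential_nonempty w2 cf2.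
  exists (fun u => u.1 * (f1 w1 + inner xi1 (u.2.1.1 - w1)) +
    (1 - u.1) * (f2 w2 + inner xi2 (u.2.2.1 - w2))); split=> /=.
  + apply: (mix (fun u => f1 w1 + inner xi1 (u.2.1.1 - w1))
      (fun u => f2 w2 + inner xi2 (u.2.2.1 - w2))) => u.
      apply: (@continuous_comp _ _ _ (fun u : P => u.2.1.1)
        (fun w => f1 w1 + inner xi1 (w - w1))); first exact: cw1.
      exact: affine_continuous.
    apply: (@continuous_comp _ _ _ (fun u : P => u.2.2.1)
        (fun w => f2 w2 + inner xi2 (w - w2))); first exact: cw2.
      exact: affine_continuous.
  + by rewrite !subrr /inner !big1 ?addr0// => j _; rewrite mxE mulr0.
  + move=> u [/andP[du ud] _ _ _]; apply: lerD; apply: ler_wpM2l.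
    * by rewrite (le_trans (ltW d0)).
    * exact: hxi1.
    * lra.
    * exact: hxi2.
exists a, w1, w2; split.
  case: Aw => /= /andP[da ad] [Zw1 wt1 _] [Zw2 wt2 _] tb.
  have [a_ge0 a_le1] : 0 <= a /\ 0 <= 1 - a by split; lra.
  split=> //; first by rewrite a_ge0; lra.
  apply: le_trans tb; apply: lerD; exact: ler_wpM2l.
move=> a' w1' w2' da' feas'.
exact: (wmax (a', ((w1', c w1' z), (w2', c w2' z))) (feasA _ _ _ da' feas')).
Qed.

End Attainment.

Section LocalUtility.
Variables (R : realType) (m : nat).
Implicit Types (f : 'rV[R]_m -> R) (v w x y z xi : 'rV[R]_m) (a b r s t : R).
Variables (Z : set 'rV[R]_m) (c : 'rV[R]_m -> 'rV[R]_m -> R).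
Hypotheses (hc : transport_cost Z c) (closedZ : closed Z).
Hypothesis convexZ : convex_set (Z : set (convex_lmodType 'rV[R]_m)).
Variables (nrm : 'rV[R]_m -> R) (p : R).
Hypotheses (hn : is_norm nrm) (p1 : 1 <= p).
Hypothesis cost_ge :
  forall z w, Z z -> Z w -> nrm (z - w) `^ p <= c z w.

Definition sublinear_growth f z := forall eta, 0 < eta ->
  exists M, forall w, Z w -> f w <= M + eta * c w z.

Lemma small_weight f1 f2 z b M e : concave_function setT f2 -> Z z ->
  0 <= b -> 0 < e -> sublinear_growth f1 z ->
  (forall w, Z w -> c w z <= b -> f2 w <= M) ->
  exists2 d, 0 < d & forall a w1 w2, a < d ->
    pair_feasible Z (c^~ z) b a w1 w2 ->
    a * f1 w1 + (1 - a) * f2 w2 < M + e.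
Proof.
move=> cf2 Zz b0 e0 sub1 f2M.
have b1 : 0 < 2 * (b + 1) by rewrite mulr_gt0// ltr_wpDl.
pose eta := e / (2 * (b + 1)).
have eta0 : 0 < eta by rewrite divr_gt0.
have [K f1K] := sub1 eta eta0.
pose D := `|K - f2 z| + 1.
have D0 : 0 < D by rewrite ltr_wpDl.
exists (e / (2 * D)); first by rewrite divr_gt0// mulr_gt0.
move=> a w1 w2; rewrite ltr_pdivlMr ?mulr_gt0// => aD.
move=> [/andP[a0 a1] Zw1 Zw2 wb].
have [g1 g2] := (cost_ge0 hc Zw1 Zz, cost_ge0 hc Zw2 Zz).
have a1' : 0 <= 1 - a by rewrite subr_ge0.
have a01 : 0 <= 1 - a <= 1 by rewrite a1' lerBlDr lerDl.
have f2w : (1 - a) * f2 w2 + a * f2 z <= M.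
  have := concave_function_comb w2 z cf2 a01; rewrite subKr => /le_trans; apply.
  apply: f2M.
    by have := convex_set_comb convexZ Zw2 Zz a01; rewrite subKr.
  have := convex_function_comb (cost_convex hc Zz) Zw2 Zz a01.
  rewrite subKr (cost_diag hc Zz) mulr0 addr0 => /le_trans; apply.
  by apply: le_trans wb; rewrite lerDr mulr_ge0.
have f1w : a * f1 w1 <= a * K + eta * b.
  have := ler_wpM2l a0 (f1K w1 Zw1); rewrite mulrDr => /le_trans; apply.
  rewrite lerD2l mulrCA ler_pM2l//.
  by apply: le_trans wb; rewrite lerDl mulr_ge0.
have aK : a * (K - f2 z) <= a * D.
  by rewrite ler_wpM2l// /D (le_trans (ler_norm _))// lerDl.
have etab : eta * b <= e / 2.
  rewrite /eta mulrAC ler_pdivrMr//.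
  by have -> : e / 2 * (2 * (b + 1)) = e * b + e by [field]; rewrite lerDl ltW.
lra.
Qed.

Lemma pair_feasible_sym z b a w1 w2 : pair_feasible Z (c^~ z) b a w1 w2 ->
  pair_feasible Z (c^~ z) b (1 - a) w2 w1.
Proof.
move=> [a01 Zw1 Zw2 wb]; split=> //; first by lra.
by rewrite subKr addrC.
Qed.

Lemma pair_max f1 f2 z b :
  concave_function setT f1 -> concave_function setT f2 -> Z z -> 0 <= b ->
  sublinear_growth f1 z -> sublinear_growth f2 z ->
  exists a w1 w2, pair_feasible Z (c^~ z) b a w1 w2 /\
    forall a' w1' w2', pair_feasible Z (c^~ z) b a' w1' w2' ->
      a' * f1 w1' + (1 - a') * f2 w2' <= a * f1 w1 + (1 - a) * f2 w2.
Proof.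
move=> cf1 cf2 Zz b0 sub1 sub2.
have [u1 [Zu1 u1b u1max]] := budget_max hc closedZ hn p1 cost_ge cf1 Zz b0.
have [u2 [Zu2 u2b u2max]] := budget_max hc closedZ hn p1 cost_ge cf2 Zz b0.
have feas1 : pair_feasible Z (c^~ z) b 1 u1 z.
  by split; rewrite ?ler01 ?lexx//= subrr mul1r mul0r addr0.
have feas2 : pair_feasible Z (c^~ z) b 0 z u2.
  by split; rewrite ?ler01 ?lexx//= subr0 mul1r mul0r add0r.
pose M := Num.max (f1 u1) (f2 u2).
have [[a0 [v1 [v2 [feas0 Mv]]]]|none] := pselect (exists a w1 w2,
    pair_feasible Z (c^~ z) b a w1 w2 /\ M < a * f1 w1 + (1 - a) * f2 w2);
    last first.
  have below a w1 w2 : pair_feasible Z (c^~ z) b a w1 w2 ->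
      a * f1 w1 + (1 - a) * f2 w2 <= M.
    move=> feas; rewrite leNgt; apply/negP => Mw.
    by apply: none; exists a, w1, w2.
  have [f12|f21] := leP (f1 u1) (f2 u2).
    exists 0, z, u2; split=> // a w1 w2 /below.
    by rewrite subr0 mul1r mul0r add0r /M (max_idPr f12).
  exists 1, u1, z; split=> // a w1 w2 /below.
  by rewrite subrr mul1r mul0r addr0 /M (max_idPl (ltW f21)).
pose e := a0 * f1 v1 + (1 - a0) * f2 v2 - M.
have e0 : 0 < e by rewrite subr_gt0.
have u1M w : Z w -> c w z <= b -> f1 w <= M.
  by move=> Zw wb; rewrite le_max u1max.
have u2M w : Z w -> c w z <= b -> f2 w <= M.
  by move=> Zw wb; rewrite le_max u2max ?orbT.
have [d1 d10 small1] := small_weight cf2 Zz b0 e0 sub1 u2M.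
have [d2 d20 small2] := small_weight cf1 Zz b0 e0 sub2 u1M.
pose d := Num.min d1 d2.
have outside a w1 w2 : pair_feasible Z (c^~ z) b a w1 w2 ->
    ~~ (d <= a <= 1 - d) ->
    a * f1 w1 + (1 - a) * f2 w2 < a0 * f1 v1 + (1 - a0) * f2 v2.
  move=> feas; rewrite negb_and -!ltNge.
  have -> : a0 * f1 v1 + (1 - a0) * f2 v2 = M + e.
    by rewrite /e addrCA subrr addr0.
  case/orP => ad.
    by apply: small1 => //; rewrite (lt_le_trans ad)// ge_min lexx.
  have dd2 : d <= d2 by rewrite ge_min lexx orbT.
  have ad2 : 1 - a < d2 by lra.
  have := small2 _ _ _ ad2 (pair_feasible_sym feas).
  by rewrite subKr [(1 - a) * _ + _]addrC.
have inside0 : d <= a0 <= 1 - d.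
  by apply: contraT => /(outside _ _ _ feas0); rewrite ltxx.
have d0 : 0 < d by rewrite lt_min d10.
have [a [w1 [w2 [feas amax]]]] :=
  interior_pair_max hc closedZ hn p1 cost_ge cf1 cf2 Zz d0 inside0 feas0.
exists a, w1, w2; split=> // a' w1' w2' feas'.
have [ins|/(outside _ _ _ feas')/ltW out] := boolP (d <= a' <= 1 - d).
  exact: amax.
exact: le_trans out (amax _ _ _ inside0 feas0).
Qed.

Lemma pair_shrink f1 f2 z b b' a w1 w2 G :
  concave_function setT f1 -> concave_function setT f2 -> Z z -> 0 <= G ->
  (forall w, f1 w - f1 z <= G * nrm (w - z)) ->
  (forall w, f2 w - f2 z <= G * nrm (w - z)) ->
  0 <= b' <= b -> pair_feasible Z (c^~ z) b a w1 w2 ->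
  exists w1' w2', pair_feasible Z (c^~ z) b' a w1' w2' /\
    a * f1 w1 + (1 - a) * f2 w2 <=
    a * f1 w1' + (1 - a) * f2 w2' + G * (b - b') `^ p^-1.
Proof.
move=> cf1 cf2 Zz G0 fG1 fG2 /andP[b'0 b'b] feas.
have [b0|b_neq0] := eqVneq b 0.
  have -> : b' = b by apply/eqP; rewrite eq_le b'b b0.
  by exists w1, w2; split=> //; rewrite lerDl mulr_ge0 ?powR_ge0.
case: feas => /andP[a0 a1] Zw1 Zw2 wb.
have b_ge0 : 0 <= b by exact: le_trans b'b.
have b0 : 0 < b by rewrite lt_def b_neq0.
pose t := b' / b.
have tb : t * b = b' by rewrite /t divfK.
have t01 : 0 <= t <= 1 by rewrite divr_ge0//= ler_pdivrMr// mul1r.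
have [t0 t1] := andP t01.
have t1' : 0 <= 1 - t by rewrite subr_ge0.
have a1' : 0 <= 1 - a by rewrite subr_ge0.
pose sh w := t *: w + (1 - t) *: z.
have Zsh w : Z w -> Z (sh w) by move=> Zw; exact: convex_set_comb.
have csh w : Z w -> c (sh w) z <= t * c w z.
  move=> Zw; have := convex_function_comb (cost_convex hc Zz) Zw Zz t01.
  by rewrite (cost_diag hc Zz) mulr0 addr0.
have fsh f w : concave_function setT f ->
    (forall w, f w - f z <= G * nrm (w - z)) ->
    f w <= f (sh w) + (1 - t) * (G * nrm (w - z)).
  move=> cf fG; have := concave_function_comb w z cf t01.
  have := ler_wpM2l t1' (fG w); rewrite -/(sh w); lra.
exists (sh w1), (sh w2); split.
  split; [by rewrite a0|exact: Zsh|exact: Zsh|].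
  have := ler_wpM2l a0 (csh w1 Zw1); have := ler_wpM2l a1' (csh w2 Zw2).
  have := ler_wpM2l t0 wb; rewrite tb /=; lra.
have mean : a * nrm (w1 - z) + (1 - a) * nrm (w2 - z) <= b `^ p^-1.
  apply: mean_le_root; rewrite ?is_norm_ge0// ?a0//.
  apply: le_trans wb; apply: lerD; apply: ler_wpM2l => //; exact: cost_ge.
have tp : (1 - t) * b `^ p^-1 <= (b - b') `^ p^-1.
  have -> : b - b' = (1 - t) * b by rewrite mulrBl mul1r tb.
  rewrite powRM ?(ltW b0)// ler_wpM2r ?powR_ge0//.
  by apply: le_powR_root => //; rewrite t1' lerBlDr lerDl.
have := ler_wpM2l G0 tp; have := ler_wpM2l (mulr_ge0 G0 t1') mean.
have := ler_wpM2l a0 (fsh f1 w1 cf1 fG1).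
have := ler_wpM2l a1' (fsh f2 w2 cf2 fG2).
lra.
Qed.

Lemma sublinear_growth_gt1 f z G : 1 < p -> Z z -> 0 <= G ->
  (forall w, f w - f z <= G * nrm (w - z)) -> sublinear_growth f z.
Proof.
move=> p_gt1 Zz G0 fG eta eta0.
have G1 : 0 < G + 1 by rewrite ltr_wpDl.
have [M nM] := @powR_sublinear R 1 p (eta / (G + 1))
  ltac:(by rewrite ler01) (divr_gt0 eta0 G1).
exists (f z + G * M) => w Zw.
have n0 := is_norm_ge0 hn (w - z); have cw := cost_ge Zw Zz.
have c0 := cost_ge0 hc Zw Zz.
have := nM _ n0; rewrite powRr1// => nMw.
have Geta : G * (eta / (G + 1)) <= eta.
  by rewrite mulrCA ler_piMr ?(ltW eta0)// ler_pdivrMr// mul1r lerDl.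
have := fG w; have := ler_wpM2l G0 nMw.
have := ler_wpM2l c0 Geta.
have := ler_wpM2l (mulr_ge0 G0 (ltW (divr_gt0 eta0 G1))) cw.
lra.
Qed.

Lemma sublinear_growth_eq1 f z z0 g r : p = 1 -> Z z -> 0 < g -> 0 <= r < 1 ->
  (forall w, Z w -> f w <= g * (1 + nrm (w - z0) `^ r)) ->
  sublinear_growth f z.
Proof.
move=> p_eq1 Zz g0 r01 fg eta eta0.
have [M nM] := powR_sublinear r01 (divr_gt0 eta0 g0).
exists (g * (1 + M) + eta * nrm (z - z0)) => w Zw.
have := nM _ (is_norm_ge0 hn (w - z0)); rewrite powRr1 ?is_norm_ge0// => nMw.
have := cost_ge Zw Zz; rewrite p_eq1 powRr1 ?is_norm_ge0// => cw.
have tri : nrm (w - z0) <= nrm (w - z) + nrm (z - z0).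
  by case: hn => nD _ _; have := nD (w - z) (z - z0); rewrite addrA subrK.
have := fg w Zw; have := ler_wpM2l (ltW g0) nMw.
have -> : g * (M + eta / g * nrm (w - z0)) = g * M + eta * nrm (w - z0).
  by field; rewrite gt_eqF.
have := ler_wpM2l (ltW eta0) tri; have := ler_wpM2l (ltW eta0) cw.
lra.
Qed.

End LocalUtility.

(** * Utilities as maxima *)

Lemma pair_utilityE (R : realType) (m K : nat) (Z : set 'rV[R]_m)
    (c : 'rV[R]_m -> 'rV[R]_m -> R) (ell : 'I_K -> 'rV[R]_m -> R)
    (z : 'rV[R]_m) (k1 k2 : 'I_K) (b a : R) (w1 w2 : 'rV[R]_m) :
  transport_cost Z c -> Z z -> pair_feasible Z (c^~ z) b a w1 w2 ->
  (forall a' w1' w2', pair_feasible Z (c^~ z) b a' w1' w2' ->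
    a' * ell k1 w1' + (1 - a') * ell k2 w2' <=
    a * ell k1 w1 + (1 - a) * ell k2 w2) ->
  pair_utility Z c ell z k1 k2 b = a * ell k1 w1 + (1 - a) * ell k2 w2.
Proof.
move=> hc Zz [/andP[a0 a1] Zw1 Zw2 wb] amax; apply: maximumE.
  have zK w : z + (w - z) = w by rewrite addrC subrK.
  have [g1 g2] := (cost_ge0 hc Zw1 Zz, cost_ge0 hc Zw2 Zz).
  have a1' : 0 <= 1 - a by rewrite subr_ge0.
  exists a, (1 - a), (a * c w1 z), (b - a * c w1 z), (w1 - z), (w2 - z).
  rewrite !zK; split=> //.
  - split=> //; first by rewrite mulr_ge0.
    by rewrite subr_ge0 (le_trans _ wb)// lerDl mulr_ge0.
  - by split=> //; rewrite lerBrDl.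
  - by split; rewrite addrC subrK.
move=> t [a' [a2 [b1 [b2 [v1 [v2 []]]]]]].
move=> [a'0 a20 _ _] [Zv1 Zv2] [cb1 cb2] [aa bb] ->.
have a2E : a2 = 1 - a' by lra.
rewrite a2E in a20 cb2 *; apply: amax; split=> //; first by lra.
by rewrite -bb; apply: lerD.
Qed.

Lemma pair_utility_modulus (R : realType) (m K : nat) (Z : set 'rV[R]_m)
    (c : 'rV[R]_m -> 'rV[R]_m -> R) (nrm : 'rV[R]_m -> R) (p : R)
    (ell : 'I_K -> 'rV[R]_m -> R) (z : 'rV[R]_m) (G : R) :
  transport_cost Z c -> closed Z ->
  convex_set (Z : set (convex_lmodType 'rV[R]_m)) -> is_norm nrm -> 1 <= p ->
  (forall z w, Z z -> Z w -> nrm (z - w) `^ p <= c z w) -> Z z -> 0 <= G ->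
  (forall k, concave_function setT (ell k)) ->
  (forall k w, ell k w - ell k z <= G * nrm (w - z)) ->
  (forall k, sublinear_growth Z c (ell k) z) ->
  forall k1 k2 b b', 0 <= b' <= b ->
  pair_utility Z c ell z k1 k2 b' <= pair_utility Z c ell z k1 k2 b
  <= pair_utility Z c ell z k1 k2 b' + G * (b - b') `^ p^-1.
Proof.
move=> hc closedZ convexZ hn p1 cost_ge Zz G0 conc lip sub k1 k2 b b' b'b.
have [b'0 b'_le] := andP b'b; have b0 := le_trans b'0 b'_le.
have [a [w1 [w2 [feas amax]]]] := pair_max hc closedZ convexZ hn p1 cost_ge
  (conc k1) (conc k2) Zz b0 (sub k1) (sub k2).
have [a' [w1' [w2' [feas' amax']]]] := pair_max hc closedZ convexZ hn p1 cost_ge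
  (conc k1) (conc k2) Zz b'0 (sub k1) (sub k2).
rewrite (pair_utilityE hc Zz feas amax) (pair_utilityE hc Zz feas' amax').
apply/andP; split.
  by apply: amax; case: feas' => ? ? ? le_b'; split=> //; exact: le_trans b'_le.
have [v1 [v2 [feasv le_v]]] := pair_shrink hc convexZ hn p1 cost_ge
  (conc k1) (conc k2) Zz G0 (lip k1) (lip k2) b'b feas.
by apply: le_trans le_v _; rewrite lerD2r; apply: amax'.
Qed.

Lemma local_utilityE (R : realType) (m K : nat) (Z : set 'rV[R]_m)
    (c : 'rV[R]_m -> 'rV[R]_m -> R) (ell : 'I_K -> 'rV[R]_m -> R)
    (z : 'rV[R]_m) (b : R) : (2 <= K)%N ->
  exists k1 k2 : 'I_K, [/\ (k1 < k2)%N,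
    local_utility Z c ell z b = pair_utility Z c ell z k1 k2 b &
    forall j1 j2 : 'I_K, (j1 < j2)%N ->
      pair_utility Z c ell z j1 j2 b <= local_utility Z c ell z b].
Proof.
move=> K2; pose F (k : 'I_K * 'I_K) := pair_utility Z c ell z k.1 k.2 b.
have [|[k1 k2] /= k12 kmax] :=
    @finite_max _ _ (fun k : 'I_K * 'I_K => (k.1 < k.2)%N) F.
  by exists (Ordinal (ltnW K2), Ordinal K2).
have <- : pair_utility Z c ell z k1 k2 b = local_utility Z c ell z b.
  symmetry; apply: maximumE; first by exists k1, k2.
  by move=> _ [j1 [j2 [j12 ->]]]; exact: (kmax (j1, j2)).
by exists k1, k2; split=> // j1 j2 j12; exact: (kmax (j1, j2)).
Qed.

Lemma local_growth_spec (R : realType) (m K : nat) (nrm : 'rV[R]_m -> R)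
    (ell : 'I_K -> 'rV[R]_m -> R) (z : 'rV[R]_m) :
  is_norm nrm -> (0 < K)%N -> (forall k, concave_function setT (ell k)) ->
  0 <= local_growth ell nrm z /\
  forall k w, ell k w - ell k z <= local_growth ell nrm z * nrm (w - z).
Proof.
move=> hn K0 conc; pose D k := maximum
  [set dual_norm nrm xi | xi in superdifferential (ell k) z].
have DE k : exists2 xi, superdifferential (ell k) z xi & D k = dual_norm nrm xi.
  have [xi Sxi ximax] := dual_norm_superdifferential_max hn z (conc k).
  exists xi => //; apply: maximumE; first by exists xi.
  by move=> _ [xi' Sxi' <-]; exact: ximax.
have [|k _ kmax] := @finite_max _ _ predT D; first by exists (Ordinal K0).
have -> : local_growth ell nrm z = D k.
  by apply: maximumE; [exists k|move=> _ [j _ <-]; exact: kmax].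
split=> [|j w].
  have [xi _ ->] := DE k; have [_ [_ _ /(_ 0)]] := dual_norm_attained hn xi.
  rewrite is_norm0// => /(_ ler01); rewrite /inner big1//.
  by move=> i _; rewrite mxE mulr0.
have [xi Sxi Dxi] := DE j.
apply: (@le_trans _ _ (D j * nrm (w - z))); last first.
  by rewrite ler_wpM2r ?is_norm_ge0// kmax.
by rewrite Dxi; apply: le_trans (inner_le_dual_norm hn xi _); rewrite lerBlDl.
Qed.

Lemma le_max_loss (R : realType) (n m K : nat)
    (ell : 'I_K -> 'rV[R]_n -> 'rV[R]_m -> R) x z k :
  ell k x z <= max_loss ell x z.
Proof.
have [|j _ jmax] := @finite_max _ _ predT (fun k => ell k x z).
  by exists k.
rewrite /max_loss (@maximumE _ _ (ell j x z)); first exact: jmax.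
  by exists j.
by move=> _ [i _ <-]; exact: jmax.
Qed.

Theorem lemma12 (R : realType) (n m K N : nat)
  (X : set 'rV[R]_n) (Z : set 'rV[R]_m)
  (c : 'rV[R]_m -> 'rV[R]_m -> R) (hc : transport_cost Z c)
  (zhat : 'I_N -> 'rV[R]_m) (hzhat : forall i, Z (zhat i))
  (rho : R) (hrho : 0 < rho)
  (ell : 'I_K -> 'rV[R]_n -> 'rV[R]_m -> R)
  (nrm : 'rV[R]_m -> R) (p : R)
  (hreg : regularity X Z c zhat rho ell nrm p)
  (x : 'rV[R]_n) (hx : X x)
  (oracle : 'I_K -> 'rV[R]_m -> R -> R -> 'rV[R]_m * R)
  (horacle : local_worst_case_oracle Z c (fun k => ell k x) oracle)
  (i : 'I_N) (b b' : R) (hb : 0 <= b) (hb' : 0 <= b') :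
  `|local_utility Z c (fun k => ell k x) (zhat i) b
    - local_utility Z c (fun k => ell k x) (zhat i) b'|
  <= local_growth (fun k => ell k x) nrm (zhat i) * `|b - b'| `^ p^-1.
Proof.
have [_ _ _ _ closedZ convexZ K2 _ conc hn p1 cost_ge growth] := hreg.
have {}conc k : concave_function setT (ell k x) by exact: conc.
have Zz := hzhat i; set z := zhat i in Zz *.
have [G0 lip] := local_growth_spec z hn (ltnW K2) conc.
set G := local_growth _ _ _ in G0 lip *.
have sub k : sublinear_growth Z c (ell k x) z.
  have [p_eq1|p_neq1] := eqVneq p 1.
    have [g [z0 [r [g0 _ r01 loss]]]] := growth p_eq1 x hx.
    apply: (sublinear_growth_eq1 hn cost_ge p_eq1 Zz g0 r01) => w Zw.
    exact: le_trans (le_max_loss ell x w k) (loss w Zw).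
  apply: (sublinear_growth_gt1 hc hn cost_ge _ Zz G0) (lip k).
  by rewrite lt_neqAle eq_sym p_neq1.
have modulus := pair_utility_modulus hc closedZ convexZ hn p1 cost_ge Zz G0
  conc lip sub.
wlog b'b : b b' hb hb' / b' <= b => [thm|].
  have [|/ltW] := leP b' b; first exact: thm.
  by rewrite distrC [`|b - b'|]distrC; exact: thm.
rewrite (ger0_norm (_ : 0 <= b - b')) ?subr_ge0//.
set ell_x := fun k => ell k x.
have [k1 [k2 [k12 VE kmax]]] := local_utilityE Z c ell_x z b K2.
have [j1 [j2 [j12 VE' jmax]]] := local_utilityE Z c ell_x z b' K2.
have b'b0 : 0 <= b' <= b by rewrite hb'.
have [_] := andP (modulus k1 k2 b b' b'b0); rewrite -VE.
have [] := andP (modulus j1 j2 b b' b'b0); rewrite -VE'.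
have := jmax k1 k2 k12; have := kmax j1 j2 j12.
by rewrite ler_norml; lra.
Qed.
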